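(* Let $\sim$ be a prelambda congruence. Then $\sim$ is an extensional congruence if and only if it satisfies the following condition of extensionality for terms: for all terms $A, B$, if $AD \sim BD$ for every term $D$, then $A \sim B$.
   Context: Let $\mathbb{V}$ be an infinite set whose elements are called variables. The set $\mathbb{T}$ of terms is the set of words inductively defined by: every variable $x$ is a term; if $A,B$ are terms then $[AB]$ is a term; if $x$ is a variable and $A$ a term then $[\lambda x A]$ is a term. Equality of terms is syntactic identity. We abbreviate $[AB]$ as $AB$ and $[\lambda x A]$ as $\lambda x A$. A binary relation $\sim$ on $\mathbb{T}$ is a congruence if it is reflexive, symmetric, transitive, and for all terms $A,B,C,D$ and every variable $x$: $A\sim B$ implies $\lambda x A \sim \lambda x B$, and $A\sim B$, $C \sim D$ imply $AC \sim BD$. A prelambda congruence is a congruence $\sim$ such that for all terms $A,B,D$ and all variables $x,y$: ($\beta_1$) $[\lambda x x]D \sim D$; ($\beta_2$) $[\lambda x y]D \sim y$ whenever $x\neq y$; ($\beta_3$) $[\lambda x[AB]]D \sim [[\lambda x A]D][[\lambda x B]D]$; ($\beta_4$) $[\lambda x[\lambda x A]]D \sim \lambda x A$; ($\beta_5$) if $x \neq y$ and $[\lambda y D]x \sim D$, then $[\lambda x[\lambda y A]]D \sim \lambda y[[\lambda x A]D]$. An extensional congruence is a prelambda congruence $\sim$ satisfying ($\eta_e$): $y \sim \lambda x[yx]$ for all variables $x, y$ with $x \neq y$. *)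

(* Defs.v *)
From Stdlib Require Import Relations.

Set Implicit Arguments.

(* Terms are raw syntax trees: they are not identified up to
   alpha-equivalence, and [=] is syntactic identity. *)
Inductive term (V : Type) : Type :=
| Var : V -> term V
| App : term V -> term V -> term V
| Lam : V -> term V -> term V.

Record congruence (V : Type) (R : relation (term V)) : Prop := {
  congruence_equiv : equivalence (term V) R;
  congruence_lam : forall (x : V) (A B : term V),
    R A B -> R (Lam x A) (Lam x B);
  congruence_app : forall A B C D : term V,
    R A B -> R C D -> R (App A C) (App B D)
}.

(* No notion of free variable or substitution is involved: in [beta5] the
   condition [R (App (Lam y D) (Var x)) D] plays the role of
   "y is not free in D". *)
Record prelambda_congruence (V : Type) (R : relation (term V)) : Prop := {
  prelambda_is_congruence : congruence R;
  beta1 : forall (x : V) (D : term V),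
    R (App (Lam x (Var x)) D) D;
  beta2 : forall (x y : V) (D : term V),
    x <> y -> R (App (Lam x (Var y)) D) (Var y);
  beta3 : forall (x : V) (A B D : term V),
    R (App (Lam x (App A B)) D) (App (App (Lam x A) D) (App (Lam x B) D));
  beta4 : forall (x : V) (A D : term V),
    R (App (Lam x (Lam x A)) D) (Lam x A);
  beta5 : forall (x y : V) (A D : term V),
    x <> y -> R (App (Lam y D) (Var x)) D ->
    R (App (Lam x (Lam y A)) D) (Lam y (App (Lam x A) D))
}.

Record extensional_congruence (V : Type) (R : relation (term V)) : Prop := {
  extensional_is_prelambda : prelambda_congruence R;
  eta_e : forall x y : V,
    x <> y -> R (Var y) (Lam x (App (Var y) (Var x)))
}.

Definition extensional_for_terms (V : Type) (R : relation (term V)) : Prop :=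
  forall A B : term V, (forall D : term V, R (App A D) (App B D)) -> R A B.

(* Main.v *)
Require Import Defs.
From Stdlib Require Import Relations FinFun.
From Stdlib Require Import List Classical Setoid Morphisms.
Import ListNotations.

(** If [x] does not occur in [A], and [y] is a fresh variable, then
    [[λx A]y ~ A], by induction on [A]; this is the side condition of (β5) that
    allows [A] to be substituted for [y] in [λy y ~ λy λx [yx]], which gives
    [A ~ λx[Ax]].  Extensionality follows by taking [D] to be a variable [x]
    that occurs in neither of the two terms.  Conversely,
    [[λx[yx]]D ~ yD] by (β1), (β2), (β3). *)

(* Binders are included, so that a variable outside this list needs no
   renaming when it is substituted. *)
Fixpoint occurring {V : Type} (A : term V) : list V :=
  match A with
  | Var x => [x]
  | App A B => occurring A ++ occurring B
  | Lam x A => x :: occurring A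
  end.

Lemma fresh_variable {V : Type} (V_infinite : ~ Finite V) (l : list V) :
  exists x, ~ In x l.
Proof.
  apply not_all_ex_not; intros H; apply V_infinite; exists l; exact H.
Qed.

(* Lets instance resolution pick up the hypothesis on [R] from the context, so that [rewrite] works
   modulo [R], also under [Lam]. *)
Existing Class prelambda_congruence.

#[local] Instance congruence_Equivalence (V : Type) (R : relation (term V))
  (H : prelambda_congruence R) : Equivalence R.
Proof.
  destruct (congruence_equiv (prelambda_is_congruence H)); now split.
Qed.

#[local] Instance App_Proper (V : Type) (R : relation (term V))
  (H : prelambda_congruence R) : Proper (R ==> R ==> R) (@App V).
Proof.
  intros A B HAB C D HCD; now apply (congruence_app (prelambda_is_congruence H)).
Qed.

#[local] Instance Lam_Proper (V : Type) (R : relation (term V))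
  (H : prelambda_congruence R) (x : V) : Proper (R ==> R) (Lam x).
Proof.
  intros A B HAB; now apply (congruence_lam (prelambda_is_congruence H)).
Qed.

(** The argument is a variable so that the induction passes a binder [z]: there (β5) asks for
    [λz y]x ~ y, which is (β2) since y ≠ z. *)
Lemma vacuous_substitution {V : Type} {R : relation (term V)}
    (H : prelambda_congruence R) (x y : V) (A : term V) :
  ~ In x (occurring A) -> ~ In y (occurring A) ->
  R (App (Lam x A) (Var y)) A.
Proof.
  induction A as [z | A IHA B IHB | z A IHA]; simpl; intros Hx Hy.
  - apply (beta2 H); intuition congruence.
  - rewrite in_app_iff in Hx, Hy.
    rewrite (beta3 H), IHA, IHB by tauto; reflexivity.
  - rewrite (beta5 H).
    + rewrite IHA by tauto; reflexivity.
    + intuition congruence.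
    + apply (beta2 H); intuition congruence.
Qed.

Lemma eta_variable_app {V : Type} {R : relation (term V)}
    (H : prelambda_congruence R) {x y : V} (D : term V) :
  x <> y -> R (App (Lam x (App (Var y) (Var x))) D) (App (Var y) D).
Proof.
  intros Hxy.
  rewrite (beta3 H), (beta2 H), (beta1 H) by exact Hxy; reflexivity.
Qed.

Lemma eta_term {V : Type} (V_infinite : ~ Finite V) {R : relation (term V)}
    (E : extensional_congruence R) (x : V) (A : term V) :
  ~ In x (occurring A) -> R A (Lam x (App A (Var x))).
Proof.
  intros Hx; pose proof (extensional_is_prelambda E) as H.
  (* (η_e), (β2) and (β5) below also need y ≠ x. *)
  destruct (fresh_variable V_infinite (x :: occurring A)) as [y Hy].
  simpl in Hy.
  assert (Hxy : x <> y) by tauto.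
  (* This redex reduces in two ways: contracting λx[yx] to y first leaves [λy y]A ~ A, while pushing
     [A] under λx by (β5) leaves λx[Ax]. *)
  transitivity (App (Lam y (Lam x (App (Var y) (Var x)))) A).
  - rewrite <- (eta_e E Hxy), (beta1 H); reflexivity.
  - rewrite (beta5 H).
    + rewrite (beta3 H), (beta1 H), (beta2 H) by congruence; reflexivity.
    + congruence.
    + apply vacuous_substitution; tauto.
Qed.

Theorem theorem6p5 (V : Type) (V_infinite : ~ Finite V)
    (R : relation (term V)) (R_prelambda : prelambda_congruence R) :
  extensional_congruence R <-> extensional_for_terms R.
Proof.
  split.
  - intros E A B HAB.
    destruct (fresh_variable V_infinite (occurring A ++ occurring B)) as [x Hx].
    rewrite in_app_iff in Hx.
    rewrite (eta_term V_infinite E x A), (eta_term V_infinite E x B) by tauto.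
    rewrite HAB; reflexivity.
  - intros Ext; split; [exact R_prelambda |].
    intros x y Hxy; apply Ext; intros D; symmetry.
    exact (eta_variable_app R_prelambda D Hxy).
Qed.
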